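(* Let $r>0$ and let $C$ be the number of identities. For each identity $l\in\{1,\dots,C\}$, let the features of identity $l$ be distributed as a random vector $\boldsymbol{z}_l$ in $\mathbb{R}^n$ with $\|\boldsymbol{z}_l\|=r$, let $\boldsymbol{m}_l=\mathbb{E}[\boldsymbol{z}_l]\neq 0$, let $\tilde{\boldsymbol{m}}_l=r\,\boldsymbol{m}_l/\|\boldsymbol{m}_l\|$, and let $\boldsymbol{W}_l\in\mathbb{R}^n$ with $\|\boldsymbol{W}_l\|=r$ be the weight vector of identity $l$. Assume: (A1) there is a constant $\beta$ such that $\|\boldsymbol{m}_l\|=\beta$ for all $l=1,\dots,C$; (A2) $\boldsymbol{W}_l=\tilde{\boldsymbol{m}}_l$ for all $l=1,\dots,C$. Let $\boldsymbol{z}_i$ be a given feature vector of identity $i$ (so $\|\boldsymbol{z}_i\|=r$), and let $\boldsymbol{z}_j$ and $\boldsymbol{z}_k$ be random and independent feature vectors drawn from identities $j$ and $k$, respectively. If $d(\boldsymbol{z}_i,\boldsymbol{W}_j)<d(\boldsymbol{z}_i,\boldsymbol{W}_k)$, then $$\mathbb{E}[d(\boldsymbol{z}_i,\boldsymbol{z}_j)\mid \boldsymbol{z}_i]<\mathbb{E}[d(\boldsymbol{z}_i,\boldsymbol{z}_k)\mid \boldsymbol{z}_i].$$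
   Context: $d(\boldsymbol{x},\boldsymbol{y})=(\boldsymbol{x}-\boldsymbol{y})^T(\boldsymbol{x}-\boldsymbol{y})$ is the squared Euclidean distance on $\mathbb{R}^n$ and $\|\cdot\|$ is the Euclidean norm. All feature vectors and all weight vectors (proxies) lie on the sphere of radius $r>0$ centred at the origin of $\mathbb{R}^n$. The expectations conditional on $\boldsymbol{z}_i$ are taken over the random draws $\boldsymbol{z}_j$, $\boldsymbol{z}_k$ with $\boldsymbol{z}_i$ held fixed; the draws are independent of $\boldsymbol{z}_i$. *)

(* Defs.v *)
From HB Require Import structures.
From mathcomp Require Import all_boot all_order all_algebra.
From mathcomp Require Import all_classical all_reals all_analysis.

Set Implicit Arguments.
Unset Strict Implicit.
Unset Printing Implicit Defensive.

Import Order.TTheory GRing.Theory Num.Theory.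
Import numFieldNormedType.Exports.

Local Open Scope classical_set_scope.
Local Open Scope ring_scope.

Definition sqdist (R : realType) (n : nat) (x y : 'cV[R]_n) : R :=
  ((x - y)^T *m (x - y)) 0 0.

(* The library norm on matrices is the sup norm, hence this definition. *)
Definition enorm (R : realType) (n : nat) (x : 'cV[R]_n) : R :=
  Num.sqrt ((x^T *m x) 0 0).

(* Random vectors take values in [n.-tuple R], which carries the product
   sigma-algebra of the Borel sets of [R]; linear algebra is done in
   ['cV[R]_n]. *)
Definition vec (R : realType) (n : nat) (t : n.-tuple R) : 'cV[R]_n :=
  \col_a tnth t a.

Section random_vectors.
Context (R : realType) (n : nat) (d : measure_display) (T : measurableType d).
Variable P : probability T R.

(* Componentwise; [fine] sends an infinite or undefined expectation to 0, which
   does not occur for an almost surely bounded random vector. *)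
Definition mean (X : {RV P >-> n.-tuple R}) : 'cV[R]_n :=
  \col_a fine 'E_P[fun w => vec (X w) a 0].

Definition same_law (X Y : {RV P >-> n.-tuple R}) : Prop :=
  forall A : set (n.-tuple R), measurable A ->
    distribution P X A = distribution P Y A.

Definition independent (X Y : {RV P >-> n.-tuple R}) : Prop :=
  forall A B : set (n.-tuple R), measurable A -> measurable B ->
    P (X @^-1` A `&` Y @^-1` B) = (P (X @^-1` A) * P (Y @^-1` B))%E.

(* E[d(x, X) | x]: [x] is held fixed and the expectation is over the draw [X],
   which is independent of [x]. *)
Definition expected_sqdist (x : 'cV[R]_n) (X : {RV P >-> n.-tuple R}) : \bar R :=
  'E_P[fun w => sqdist x (vec (X w))].

End random_vectors.

Definition to_sphere (R : realType) (n : nat) (r : R) (x : 'cV[R]_n) : 'cV[R]_n :=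
  (r / enorm x) *: x.

(* Main.v *)
(* On the sphere of radius r, d(z, W) = 2 r^2 - 2 <z, W>, and by linearity of the
   expectation E[d(z, z_l)] = 2 r^2 - 2 <z, m_l>.  Since W_l = (r / beta) m_l with
   the same factor r / beta > 0 for all l, both sides of the implication compare
   <z, m_j> with <z, m_k>. *)
Require Import Defs.
From HB Require Import structures.
From mathcomp Require Import all_boot all_order all_algebra.
From mathcomp Require Import all_classical all_reals all_analysis.
From mathcomp Require Import measurable_realfun ring.
Import Order.TTheory GRing.Theory Num.Theory.
Import numFieldNormedType.Exports.
Local Open Scope classical_set_scope.
Local Open Scope ring_scope.

Set Implicit Arguments.
Unset Strict Implicit.
Unset Printing Implicit Defensive.

Lemma dotE (R : realType) (n : nat) (x y : 'cV[R]_n) :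
  (x^T *m y) 0 0 = \sum_a x a 0 * y a 0.
Proof. by rewrite mxE; apply: eq_bigr => a _; rewrite mxE. Qed.

Lemma dot_ge0 (R : realType) (n : nat) (x : 'cV[R]_n) : 0 <= (x^T *m x) 0 0.
Proof. by rewrite dotE sumr_ge0// => a _; rewrite -expr2 sqr_ge0. Qed.

Lemma sqr_enorm (R : realType) (n : nat) (x : 'cV[R]_n) :
  (x^T *m x) 0 0 = enorm x ^+ 2.
Proof. by rewrite sqr_sqrtr// dot_ge0. Qed.

Lemma enorm_gt0 (R : realType) (n : nat) (x : 'cV[R]_n) :
  x <> 0 -> 0 < enorm x.
Proof.
move=> x0; rewrite lt_def sqrtr_ge0 andbT; apply/negP => /eqP ex0; apply: x0.
have : (x^T *m x) 0 0 = 0 by rewrite sqr_enorm ex0 expr0n.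
rewrite dotE => /psumr_eq0P x0.
apply/matrixP => a b; rewrite ord1 mxE; apply/eqP.
rewrite -[_ == _](sqrf_eq0 (x a 0)) expr2 x0// => c _.
by rewrite -expr2 sqr_ge0.
Qed.

(** One square is at most the whole sum of squares. This turns the sphere condition into a bound on
    each coordinate. *)
Lemma coord_le_enorm (R : realType) (n : nat) (x : 'cV[R]_n) (a : 'I_n) :
  `|x a 0| <= enorm x.
Proof.
rewrite -sqrtr_sqr ler_wsqrtr// dotE (bigD1 a)//= -expr2 lerDl sumr_ge0// => b _.
by rewrite -expr2 sqr_ge0.
Qed.

Lemma sqdistE (R : realType) (n : nat) (x y : 'cV[R]_n) :
  sqdist x y = enorm x ^+ 2 + enorm y ^+ 2 - 2 * (x^T *m y) 0 0.
Proof.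
rewrite /sqdist -!sqr_enorm !dotE mulr_sumr -big_split/= -sumrB.
by apply: eq_bigr => a _; rewrite !mxE; ring.
Qed.

Lemma sqdist_ge0 (R : realType) (n : nat) (x y : 'cV[R]_n) : 0 <= sqdist x y.
Proof. exact: dot_ge0. Qed.

Section random_vectors.
Context (R : realType) (n : nat) (d : measure_display) (T : measurableType d).
Variable P : probability T R.

Lemma measurable_sqdist (x : 'cV[R]_n) :
  measurable_fun [set: n.-tuple R] (fun t => sqdist x (vec t)).
Proof.
have -> : (fun t : n.-tuple R => sqdist x (vec t)) =
    (fun t => \sum_(a <- index_enum 'I_n) (x a 0 - tnth t a) ^+ 2).
  apply/funext => t; rewrite /sqdist dotE.
  by apply: eq_bigr => a _; rewrite !mxE expr2.
apply: measurable_sum => a; apply: measurable_funX.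
by apply: measurable_funB => //; exact: measurable_tnth.
Qed.

(** Each side is the integral of one function of [t] against the law of the random vector. Since
    that function is nonnegative and measurable, the change of variables needs no integrability. *)
Lemma same_law_expected_sqdist (x : 'cV[R]_n) (X Y : {RV P >-> n.-tuple R}) :
  same_law X Y -> expected_sqdist x X = expected_sqdist x Y.
Proof.
move=> XY; rewrite /expected_sqdist unlock.
have push (V : {RV P >-> n.-tuple R}) :
    (\int[P]_w (sqdist x (vec (V w)))%:E =
     \int[distribution P V]_t (sqdist x (vec t))%:E)%E.
  rewrite ge0_integral_distribution//.
    by apply/measurable_EFinP; exact: measurable_sqdist.
  by move=> t; rewrite lee_fin sqdist_ge0.
by rewrite !push; apply: eq_measure_integral => A mA _; exact: XY.
Qed.

Variables (X : {RV P >-> n.-tuple R}) (r : R).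
Hypothesis Xr : {ae P, forall w, enorm (vec (X w)) = r}.

Lemma measurable_coord (a : 'I_n) :
  measurable_fun [set: T] (fun w => vec (X w) a 0).
Proof.
under eq_fun do rewrite mxE.
by apply: (measurableT_comp (measurable_tnth _)); exact: measurable_funPT.
Qed.

(** Almost sure boundedness suffices on a probability space. *)
Lemma integrable_coord (a : 'I_n) :
  P.-integrable [set: T] (EFin \o (fun w => vec (X w) a 0)).
Proof.
have mX := measurable_coord a.
apply/integrableP; split; first exact/measurable_EFinP.
(* The sign of [r] is not fixed here; the absolute value keeps the dominating constant
   nonnegative. *)
apply: (@le_lt_trans _ _ (\int[P]_w (cst `|r|%:E) w)%E).
  apply: ae_ge0_le_integral => //.
  - by apply: measurableT_comp => //; exact/measurable_EFinP.
  - by move=> w _; rewrite lee_fin.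
  - apply: filterS Xr => w /= Xw _.
    by rewrite lee_fin -Xw (le_trans (coord_le_enorm _ _))// ler_norm.
by rewrite integral_cst//= probability_setT mule1 ltry.
Qed.

Lemma expected_sqdistE (x : 'cV[R]_n) :
  expected_sqdist x X =
    (enorm x ^+ 2 + r ^+ 2 - 2 * (x^T *m mean X) 0 0)%:E.
Proof.
rewrite /expected_sqdist unlock.
have iX a : P.-integrable setT (fun w => (x a 0 * vec (X w) a 0)%:E).
  by under eq_fun do rewrite EFinM; apply: integrableZl => //; exact: integrable_coord.
pose S w := (\sum_(a <- index_enum 'I_n) (x a 0 * vec (X w) a 0)%:E)%E.
have iS : P.-integrable setT S by exact: integrable_sum.
(* The norm of [X w] equals [r] only almost surely, so the two integrands agree only almost
   everywhere. *)
transitivity (\int[P]_w ((enorm x ^+ 2 + r ^+ 2)%:E - 2%:E * S w))%E.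
  apply: ae_eq_integral => //.
  - apply/measurable_EFinP; apply: (measurableT_comp (measurable_sqdist x)).
    exact: measurable_funPT.
  - apply: emeasurable_funB => //; apply: measurable_funeM.
    exact: measurable_int iS.
  - apply: filterS Xr => w Xw _.
    by rewrite /S sumEFin -EFinM -EFinB sqdistE Xw dotE.
rewrite integralB//; last 2 first.
- exact: finite_measure_integrable_cst.
- exact: integrableZl.
rewrite integral_cst//= probability_setT mule1 integralZl// integral_sum//.
rewrite dotE EFinB EFinM -sumEFin; congr (_ - _ * _)%E.
apply: eq_bigr => a _; under eq_integral do rewrite EFinM.
rewrite integralZl//; last exact: integrable_coord.
(* The [fine] in [mean] loses nothing: an integrable coordinate has a finite expectation. *)
rewrite mxE unlock EFinM fineK//; apply: integrable_fin_num => //.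
exact: integrable_coord.
Qed.

End random_vectors.

Theorem proposition1 (R : realType) (n C : nat) (r : R)
    (d : measure_display) (T : measurableType d) (P : probability T R)
    (Z : 'I_C -> {RV P >-> n.-tuple R}) (W : 'I_C -> 'cV[R]_n)
    (beta : R) (i j k : 'I_C)
    (zi : 'cV[R]_n) (zj zk : {RV P >-> n.-tuple R}) :
  0 < r ->
  (forall l : 'I_C, {ae P, forall w, enorm (vec (Z l w)) = r}) ->
  (forall l : 'I_C, mean (Z l) <> 0) ->
  (forall l : 'I_C, enorm (W l) = r) ->
  (forall l : 'I_C, enorm (mean (Z l)) = beta) ->
  (forall l : 'I_C, W l = to_sphere r (mean (Z l))) ->
  enorm zi = r ->
  same_law zj (Z j) ->
  same_law zk (Z k) ->
  independent zj zk ->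
  sqdist zi (W j) < sqdist zi (W k) ->
  (expected_sqdist zi zj < expected_sqdist zi zk)%E.
Proof.
move=> r0 Zr m0 Wr mb Wm zir lawj lawk _.
(* Positivity of [beta] comes from the nonzero mean of identity [j]. *)
have rb0 : 0 < r / beta by rewrite divr_gt0// -(mb j) enorm_gt0.
have dotW l : (zi^T *m W l) 0 0 = r / beta * (zi^T *m mean (Z l)) 0 0.
  by rewrite Wm /to_sphere mb -scalemxAr mxE.
(* Cancelling the squared norms, the factor 2 and then [r / beta] leaves in [jk] that [zi] has a
   larger inner product with the mean of [Z j] than with that of [Z k]. *)
rewrite !sqdistE !Wr !dotW ltrD2l ltrN2 ltr_pM2l// ltr_pM2l// => jk.
(* The sphere condition and the means are given for [Z], so the draws are first replaced by [Z j]
   and [Z k]. *)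
rewrite (same_law_expected_sqdist _ lawj).
rewrite (same_law_expected_sqdist _ lawk).
rewrite (expected_sqdistE (Zr j)) (expected_sqdistE (Zr k)).
by rewrite lte_fin ltrD2l ltrN2 ltr_pM2l.
Qed.
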